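(* Let $\epsilon\in\{0,\frac12\}$, $b\in\mathbb{C}$, and let $M$ be an irreducible $\mathcal{D}$-module. Then the $\mathfrak{g}[\epsilon]$-module $H_{\epsilon,b}(M)$ is irreducible if and only if one of the following holds: (i) $b\notin\{0,\frac12\}$; (ii) $b=0$ and $M\not\cong\mathbb{C}[t^{\pm1}]$ as $\mathcal{D}$-modules; (iii) $b=\frac12$ and $M=D(M)$.
   Context: All vector spaces, algebras and modules are over $\mathbb{C}$; modules over Lie superalgebras are $\mathbb{Z}_2$-graded, and irreducible means nonzero with no nonzero proper ($\mathbb{Z}_2$-graded) submodule. Super-Virasoro algebra (centerless): for $\epsilon\in\{0,\frac12\}$, $\mathfrak{g}[\epsilon]$ is the Lie superalgebra with even basis $\{L_n\mid n\in\mathbb{Z}\}$, odd basis $\{G_p\mid p\in\mathbb{Z}+\epsilon\}$, and brackets $[L_m,L_n]=(m-n)L_{m+n}$, $[G_p,G_q]=2L_{p+q}$, $[L_m,G_p]=(\frac m2-p)G_{m+p}$. Weyl algebra: $\mathcal{D}$ is the associative algebra generated by $t^{\pm1}$ and $\partial_t=\frac{d}{dt}$ subject to $\partial_t t-t\partial_t=1$; put $D=t\frac{d}{dt}$. $\mathbb{C}[t^{\pm1}]$ is the natural $\mathcal{D}$-module of Laurent polynomials ($D t^n=nt^n$). $D(M)=\{Dv\mid v\in M\}$. For a $\mathcal{D}$-module $M$ let $\overline{M}=\{\overline v\mid v\in M\}$ be a copy of $M$. On $M\oplus\overline{M}$ (with $M$ even and $\overline{M}$ odd) let $x\in\mathcal{D}$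 act on $M$ as given and on $\overline{M}$ by $x\cdot\overline v=\overline{xv}$, and let $\theta\cdot v=\overline v$, $\theta\cdot\overline v=0$, $\partial_\theta\cdot v=0$, $\partial_\theta\cdot\overline v=v$ for $v\in M$. For $b\in\mathbb{C}$, $H_{\epsilon,b}(M)$ is the $\mathfrak{g}[\epsilon]$-module $M\oplus\overline{M}$ with action $$L_m\cdot v=-t^{m}\left(D+(m-2\epsilon)b+\tfrac{m+2\epsilon}{2}\theta\partial_\theta\right)v,\quad G_p\cdot v=t^{p-\epsilon}\left(\theta D+2(p-\epsilon)b\,\theta-t^{2\epsilon}\partial_\theta\right)v$$ for $m\in\mathbb{Z}$, $p\in\mathbb{Z}+\epsilon$, $v\in M\oplus\overline{M}$. *)

(* Defs.v *)
From HB Require Import structures.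
From mathcomp Require Import all_boot all_order all_algebra.
From mathcomp Require Import finmap monalg.
From mathcomp Require Import ring.

Set Implicit Arguments.
Unset Strict Implicit.
Unset Printing Implicit Defensive.

Import GRing.Theory Num.Theory.
Local Open Scope ring_scope.

Definition subspace (F : fieldType) (V : lmodType F) (N : V -> Prop) : Prop :=
  N 0 /\ forall (a : F) (u v : V), N u -> N v -> N (a *: u + v).

(* A module over the algebra presented by the generators t, t^-1, d/dt and the
   relations t t^-1 = t^-1 t = 1, (d/dt) t - t (d/dt) = 1 is a vector space with
   three linear operators satisfying these relations. *)
Record weyl_module (F : fieldType) := WeylModule {
  wcar :> lmodType F;
  wt : {linear wcar -> wcar};
  wtinv : {linear wcar -> wcar};
  wd : {linear wcar -> wcar};
  wtK : cancel wt wtinv;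
  wtinvK : cancel wtinv wt;
  wdt : forall v : wcar, wd (wt v) - wt (wd v) = v
}.

Arguments wt {F w}.
Arguments wtinv {F w}.
Arguments wd {F w}.

Section WeylModules.
Variable F : fieldType.
Implicit Types M : weyl_module F.

Definition weyl_submodule M (N : M -> Prop) : Prop :=
  subspace N /\ forall v : M, N v -> [/\ N (wt v), N (wtinv v) & N (wd v)].

Definition weyl_irreducible M : Prop :=
  (exists v : M, v != 0) /\
  forall N : M -> Prop, weyl_submodule N ->
    (exists2 v : M, N v & v != 0) -> forall v : M, N v.

Definition weyl_iso M M' : Prop :=
  exists f : {linear M -> M'}, bijective f /\
    forall v : M, [/\ f (wt v) = wt (f v), f (wtinv v) = wtinv (f v)
                    & f (wd v) = wd (f v)].

Definition wD M (v : M) : M := wt (wd v).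

Definition tpow M (m : int) (v : M) : M :=
  match m with
  | Posz n => iter n (@wt F M) v
  | Negz n => iter n.+1 (@wtinv F M) v
  end.

Lemma wD_is_linear M : linear (@wD M).
Proof. by move=> a u v; rewrite /wD !linearP. Qed.

Lemma tpow_is_linear M m : linear (@tpow M m).
Proof.
case: m => n a u v /=; last by rewrite -!iterS; elim: n.+1 => //= k ->; rewrite linearP.
by elim: n => //= k ->; rewrite linearP.
Qed.

HB.instance Definition _ M :=
  GRing.isLinear.Build F M M *:%R (@wD M) (@wD_is_linear M).
HB.instance Definition _ M m :=
  GRing.isLinear.Build F M M *:%R (@tpow M m) (@tpow_is_linear M m).

Lemma tpow_succ M m (v : M) : tpow (m + 1) v = wt (tpow m v).
Proof.
case: m => [n|[|n]]; first by rewrite -PoszD addn1.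
  by rewrite /= wtinvK.
have -> : Negz n.+1 + 1 = Negz n by rewrite !NegzE -addn1 PoszD opprD addrNK.
by rewrite /= wtinvK.
Qed.

Lemma tpow_pred M m (v : M) : tpow (m - 1) v = wtinv (tpow m v).
Proof. by rewrite -{2}[m](subrK 1) tpow_succ wtK. Qed.

Lemma tpowD M m n (v : M) : tpow m (tpow n v) = tpow (m + n) v.
Proof.
elim/int_rect: m => [|m IH|m IH]; first by rewrite add0r.
  by rewrite -addn1 PoszD tpow_succ IH addrAC tpow_succ.
by rewrite -addn1 PoszD opprD tpow_pred IH addrAC tpow_pred.
Qed.

Lemma wDt M (v : M) : wD (wt v) = wt (wD v) + wt v.
Proof. by rewrite /wD -linearD; congr (wt _); rewrite -[X in _ + X]wdt addrC subrK. Qed.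

Lemma wDtinv M (v : M) : wD (wtinv v) = wtinv (wD v) - wtinv v.
Proof.
apply: (can_inj (@wtK _ M)).
by rewrite linearB /= !wtinvK -[in RHS](wtinvK v) wDt wtinvK addrK.
Qed.

Lemma wD_tpow M m (v : M) : wD (tpow m v) = tpow m (wD v + m%:~R *: v).
Proof.
elim/int_rect: m => [|m IH|m IH]; first by rewrite scale0r addr0.
  rewrite -addn1 PoszD !tpow_succ wDt IH -linearD -linearD; congr (wt (tpow _ _)).
  by rewrite rmorphD /= scalerDl scale1r addrA.
rewrite -addn1 PoszD opprD !tpow_pred wDtinv IH -linearB -linearB.
congr (wtinv (tpow _ _)).
by rewrite rmorphB /= scalerBl scale1r addrA.
Qed.

End WeylModules.

Section Laurent.
Variable F : fieldType.

(* {malg F[int]} is the space of finitely supported functions int -> F;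
   << k >> stands for t^k. *)
Local Notation laurent := {malg F[int]}.

(* The linear map with t^k |-> c(k) t^(k+s). *)
Definition lmonom (c : int -> F) (s : int) (f : laurent) : laurent :=
  \sum_(k <- msupp f) << c k * f@_k *g k + s >>.

Lemma lmonomE c s f j : (lmonom c s f)@_j = c (j - s) * f@_(j - s).
Proof.
rewrite /lmonom raddf_sum /=.
under eq_bigr => k _ do rewrite mcoeffU [_ == j]eq_sym -subr_eq eq_sym.
case: (boolP (j - s \in msupp f)) => [jf|jNf].
  rewrite (bigD1_seq (j - s)) ?fset_uniq //= eqxx mulr1n big1 ?addr0 //.
  by move=> k /negPf; rewrite eq_sym => ->.
rewrite mcoeff_outdom // mulr0 big_seq big1 // => k kf.
by case: eqP => [Ek|//]; rewrite -Ek kf in jNf.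
Qed.

Lemma lmonom_is_linear c s : linear (lmonom c s).
Proof.
move=> a f g; apply/malgP => j.
by rewrite !(lmonomE, mcoeffD, mcoeffZ) mulrDr mulrCA.
Qed.

HB.instance Definition _ c s :=
  GRing.isLinear.Build F laurent laurent *:%R (lmonom c s) (@lmonom_is_linear c s).

Definition laurent_t : {linear laurent -> laurent} := lmonom (fun=> 1) 1.
Definition laurent_tinv : {linear laurent -> laurent} := lmonom (fun=> 1) (- 1).
Definition laurent_d : {linear laurent -> laurent} :=
  lmonom (fun k => k%:~R) (- 1).

Lemma laurent_tK : cancel laurent_t laurent_tinv.
Proof. by move=> f; apply/malgP => j; rewrite !lmonomE !mul1r opprK addrK. Qed.

Lemma laurent_tinvK : cancel laurent_tinv laurent_t.
Proof. by move=> f; apply/malgP => j; rewrite !lmonomE !mul1r opprK subrK. Qed.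

Lemma laurent_dt f : laurent_d (laurent_t f) - laurent_t (laurent_d f) = f.
Proof.
apply/malgP => j; rewrite mcoeffB !lmonomE !mul1r opprK addrK subrK.
by rewrite -mulrBl rmorphD /= addrAC subrr add0r mul1r.
Qed.

Definition laurent_module : weyl_module F :=
  WeylModule laurent_tK laurent_tinvK laurent_dt.

End Laurent.

(* Basis of g[epsilon], where epsilon = e/2 for e : bool:
   SL n is L_n and SG k is G_p with p = k + epsilon, k in Z. *)
Inductive sbasis := SL of int | SG of int.

Definition parity (x : sbasis) : bool := if x is SG _ then true else false.

Definition eps (F : fieldType) (e : bool) : F := e%:R / 2.

(* The bracket of two basis elements is a multiple of a basis element:
   sbracket F e x y = (c, z) means [x, y] = c z.  Note that
   (k + epsilon) + (l + epsilon) = k + l + e. *)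
Definition sbracket (F : fieldType) (e : bool) (x y : sbasis) : F * sbasis :=
  match x, y with
  | SL m, SL n => ((m - n)%:~R, SL (m + n))
  | SG k, SG l => (2, SL (k + l + e%:Z))
  | SL m, SG k => (m%:~R / 2 - (k%:~R + eps F e), SG (m + k))
  | SG k, SL m => (- (m%:~R / 2 - (k%:~R + eps F e)), SG (m + k))
  end.

Definition part (F : fieldType) (V0 V1 : lmodType F) (i : bool) (v : V0 * V1)
  : V0 * V1 := if i then (0, v.2) else (v.1, 0).

(* A g[epsilon]-module, with underlying Z_2-graded space seven + sodd; the
   action is given on the basis. *)
Record svir_module (F : fieldType) (e : bool) := SvirModule {
  seven : lmodType F;
  sodd : lmodType F;
  sact : sbasis -> seven * sodd -> seven * sodd;
  sact_linear : forall x, linear (sact x);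
  sact_parity : forall x i v,
    sact x (part i v) = part (i (+) parity x) (sact x v);
  sact_bracket : forall x y v,
    (sbracket F e x y).1 *: sact (sbracket F e x y).2 v =
    sact x (sact y v) - (-1) ^+ (parity x && parity y) *: sact y (sact x v)
}.

Section SvirModules.
Variables (F : fieldType) (e : bool).
Implicit Type S : svir_module F e.

Definition svir_submodule S (N : seven S * sodd S -> Prop) : Prop :=
  [/\ subspace N,
      forall i v, N v -> N (part i v)
    & forall x v, N v -> N (sact x v)].

Definition svir_irreducible S : Prop :=
  (exists v : seven S * sodd S, v != 0) /\
  forall N : seven S * sodd S -> Prop, svir_submodule N ->
    (exists2 v, N v & v != 0) -> forall v, N v.

End SvirModules.

Section H.
Variables (F : numFieldType) (e : bool) (b : F) (M : weyl_module F).
Local Notation V := (M * M)%type.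

(* (v, w) : V stands for v + \overline{w}. *)
Definition theta (u : V) : V := (0, u.1).
Definition dtheta (u : V) : V := (u.2, 0).
Definition diag (x : M -> M) (u : V) : V := (x u.1, x u.2).

Definition Hact (x : sbasis) (u : V) : V :=
  match x with
  | SL m =>
      - diag (tpow m) (diag (@wD F M) u
                       + ((m%:~R - 2 * eps F e) * b) *: u
                       + ((m%:~R + 2 * eps F e) / 2) *: theta (dtheta u))
  | SG k =>
      diag (tpow k) (theta (diag (@wD F M) u)
                     + (2 * k%:~R * b) *: theta u
                     - diag (tpow e%:Z) (dtheta u))
  end.

Let q m (x y z : F) (v : M) : M := tpow m (x *: wD (wD v) + y *: wD v + z *: v).

Let qZ a m x y z v : a *: q m x y z v = q m (a * x) (a * y) (a * z) v.
Proof. by rewrite /q -linearZ /= !scalerDr !scalerA. Qed.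

Let qN m x y z v : - q m x y z v = q m (- x) (- y) (- z) v.
Proof. by rewrite -scaleN1r qZ !mulN1r. Qed.

Let qD m x y z x' y' z' v :
  q m x y z v + q m x' y' z' v = q m (x + x') (y + y') (z + z') v.
Proof. by rewrite /q -linearD /= !scalerDl (addrACA (_ + _)) (addrACA (x *: _)). Qed.

Let q_linear m x y z : linear (q m x y z).
Proof.
move=> a u v; rewrite /q -linearP /=; congr tpow.
by rewrite !linearP /= !scalerDr !scalerA ![a * _]mulrC (addrACA ((x * a) *: _)) [LHS]addrACA.
Qed.

Let q_tpow m n y z v : q m 0 y z (tpow n v) = q (m + n) 0 y (n%:~R * y + z) v.
Proof.
rewrite /q !scale0r !add0r -tpowD; congr (tpow m _).
rewrite wD_tpow -!linearZ -linearD /=; congr (tpow n _).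
by rewrite linearZ /= scalerDr scalerA scalerDl addrA [y * _]mulrC.
Qed.

Let qq m n y z y' z' v : q m 0 y z (q n 0 y' z' v) =
  q (m + n) (y * y') (y * z' + (n%:~R * y + z) * y') ((n%:~R * y + z) * z') v.
Proof.
rewrite [q n 0 y' z' v]/q q_tpow /q !scale0r !add0r.
congr (tpow _ _).
by rewrite linearD !linearZ /= !scalerDr !scalerA !scalerDl !addrA.
Qed.

Let HL m u : Hact (SL m) u =
  (q m 0 (- 1) (- ((m%:~R - 2 * eps F e) * b)) u.1,
   q m 0 (- 1) (- ((m%:~R - 2 * eps F e) * b + (m%:~R + 2 * eps F e) / 2)) u.2).
Proof.
rewrite /Hact /diag /theta /dtheta /q /=; congr (_, _).
all: rewrite -[LHS]/(- tpow m _) -linearN /=; congr (tpow m _).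
  by rewrite scale0r add0r scaler0 addr0 opprD scaleN1r scaleNr.
by rewrite scale0r add0r -addrA -scalerDl opprD scaleN1r scaleNr.
Qed.

Let HG k u : Hact (SG k) u =
  (q (k + e%:Z) 0 0 (- 1) u.2, q k 0 1 (2 * k%:~R * b) u.1).
Proof.
rewrite /Hact /diag /theta /dtheta /q /=; congr (_, _).
  by rewrite scaler0 !add0r !scale0r !add0r scaleN1r -tpowD !linearN.
rewrite -[LHS]/(tpow k (wD u.1 + (2 * k%:~R * b) *: u.1 - tpow e%:Z 0)).
by rewrite linear0 subr0 scale0r add0r scale1r.
Qed.

Lemma Hact_linear x : linear (Hact x).
Proof. by case: x => n a u v; rewrite !(HL, HG) !q_linear. Qed.

Lemma Hact_parity x i v : Hact x (part i v) = part (i (+) parity x) (Hact x v).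
Proof.
have q0 m x' y z : q m x' y z 0 = 0 by rewrite /q !linear0 !addr0 linear0.
by case: x => n; rewrite !(HL, HG); case: i; rewrite /part /= ?q0.
Qed.

Lemma Hact_bracket x y v :
  (sbracket F e x y).1 *: Hact (sbracket F e x y).2 v =
  Hact x (Hact y v) - (-1) ^+ (parity x && parity y) *: Hact y (Hact x v).
Proof.
have E (p p' : M * M) : p.1 = p'.1 -> p.2 = p'.2 -> p = p'.
  by case: p p' => ? ? [? ?] /= -> ->.
have Q k m m' r1 r2 r3 x1 x2 x3 y1 y2 y3 w : m = k -> m' = k ->
    r1 = x1 + y1 -> r2 = x2 + y2 -> r3 = x3 + y3 ->
    q k r1 r2 r3 w = q m x1 x2 x3 w + q m' y1 y2 y3 w.
  by move=> -> -> -> -> ->; rewrite qD.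
case: x y => [m|m] [n|n];
  rewrite [parity _ && _]/= ?expr0 ?expr1 /sbracket !(HL, HG).
all: apply: E => /=; rewrite !(qZ, qq, qN); apply: Q; try ring.
all: rewrite /eps ?(rmorphB, rmorphD) /= -?pmulrn; by field.
Qed.

Definition Hmod : svir_module F e :=
  SvirModule Hact_linear Hact_parity Hact_bracket.

End H.

(* Main.v *)
Require Import Defs.
From HB Require Import structures.
From mathcomp Require Import all_boot all_order all_algebra.
From mathcomp Require Import reals complex.
From mathcomp Require Import finmap monalg.
Import GRing.Theory Num.Theory.
Local Open Scope ring_scope.

(** A graded subspace N of H_(eps,b)(M) has components N0 (even) and N1 (odd),
both regarded as subspaces of M.  Since
[[
  G_(k+eps) (v, w) = (- t^(k+2eps) w, t^k (D + 2kb) v),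
]]
a submodule N satisfies t^k N1 <= N0 and t^k (D + 2kb) N0 <= N1 for all k.
These inclusions alone force N to be everything in the irreducible cases.

If b <> 0, composing them gives t^m (D + 2kb) N0 <= N0 for all m and k; as
these operators span those of the form t^m and t^m D, N0 is a D-submodule, so
N0 = M when N is nonzero ([svir_sub_even_full]).  Conjugating by t^k then gives
N1 >= (D + k (2b - 1)) M for all k ([svir_sub_odd_affine]).  If b <> 1/2, the
values k = 0, 1 yield N1 = M; if b = 1/2, this says N1 >= D(M), which is
enough when D(M) = M, while M + D(M) is itself a submodule in general
([image_svir_submodule]).

If b = 0, the space W of all w such that t^m w lies in N1 for every m is a
D-submodule containing D(N0).  Hence N is everything as soon as D is injective
on M ([svir_sub_full_0]), whereas ker D + 0 is always a submodule
([ker_svir_submodule]).  Finally D kills a nonzero v in the irreducible M if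
and only if M is isomorphic to the Laurent polynomials: t^k |-> t^k v is a
D-linear map, onto by irreducibility, and injective because the t^k v are
eigenvectors of D for the distinct eigenvalues k
([weyl_iso_laurent_of_ker], [weyl_iso_laurent_ker]). *)

(** * Subspaces and D-modules *)

Section Subspace.
Variables (F : fieldType) (V : lmodType F) (N : V -> Prop).

Lemma subspace0 : subspace N -> N 0.
Proof. by case. Qed.

Lemma subspaceZ a u :
  subspace N -> N u -> N (a *: u).
Proof. by case=> N0 NP Nu; rewrite -[_ *: _]addr0; apply: NP. Qed.

Lemma subspaceD u v :
  subspace N -> N u -> N v -> N (u + v).
Proof. by case=> _ NP Nu Nv; rewrite -[u]scale1r; apply: NP. Qed.

Lemma subspaceN u :
  subspace N -> N u -> N (- u).
Proof. by move=> sN Nu; rewrite -scaleN1r; apply: subspaceZ. Qed.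

Lemma subspaceB u v :
  subspace N -> N u -> N v -> N (u - v).
Proof. by move=> sN Nu Nv; apply: subspaceD => //; apply: subspaceN. Qed.

End Subspace.

Section WeylModule.
Variables (F : numFieldType) (M : weyl_module F).
Implicit Types (v w : M) (N : M -> Prop).

(** Being stable under all powers of t and under D = t d/dt suffices, because
d/dt = t^-1 D. *)
Lemma weyl_submoduleP N : subspace N ->
  (forall m v, N v -> N (tpow m v)) -> (forall v, N v -> N (wD v)) ->
  weyl_submodule N.
Proof.
move=> sN Nt ND; split=> // v Nv; split; first exact: (Nt 1).
  exact: (Nt (Negz 0)).
by rewrite -[wd v]wtK; apply: (Nt (Negz 0)); apply: ND.
Qed.

Lemma tpowK m v : tpow m (tpow (- m) v) = v.
Proof. by rewrite tpowD subrr. Qed.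

Lemma tpow_wD m v : tpow m (wD v) = wD (tpow m v) - m%:~R *: tpow m v.
Proof. by rewrite wD_tpow linearD linearZ /= addrK. Qed.

(** * The map from Laurent polynomials given by a vector *)

(** The linear map from Laurent polynomials to M with t^k |-> t^k v.  It
commutes with t for every v, and with d/dt when D v = 0. *)
Definition laurent_eval v (f : {malg F[int]}) : M :=
  \sum_(k <- msupp f) f@_k *: tpow k v.

Lemma laurent_evalEw v (d : {fset int}) f : (msupp f `<=` d)%fset ->
  laurent_eval v f = \sum_(k <- d) f@_k *: tpow k v.
Proof.
move=> fd; apply: big_fset_incl => // k _ kNf.
by rewrite mcoeff_outdom // scale0r.
Qed.

Lemma laurent_eval_is_linear v : linear (laurent_eval v).
Proof.
move=> a f g; pose d := (msupp f `|` msupp g)%fset.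
rewrite (@laurent_evalEw v d) ?(@laurent_evalEw v d f) ?(@laurent_evalEw v d g).
- rewrite scaler_sumr -big_split; apply: eq_bigr => k _ /=.
  by rewrite mcoeffD mcoeffZ scalerDl scalerA.
- exact: fsubsetUr.
- exact: fsubsetUl.
- apply: fsubset_trans (msuppD_le _ _) _; apply: fsetSU; exact: msuppZ_le.
Qed.

HB.instance Definition _ v := GRing.isLinear.Build F {malg F[int]} M *:%R
  (laurent_eval v) (laurent_eval_is_linear v).

Lemma laurent_evalU v a k : laurent_eval v << a *g k >> = a *: tpow k v.
Proof.
by rewrite (laurent_evalEw _ _ _ msuppU_le) big_seq_fset1 mcoeffUU.
Qed.

Lemma laurent_eval_lmonom v c s f : laurent_eval v (lmonom c s f) =
  \sum_(k <- msupp f) (c k * f@_k) *: tpow (k + s) v.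
Proof.
by rewrite /lmonom linear_sum; apply: eq_bigr => k _ /=; rewrite laurent_evalU.
Qed.

Lemma laurent_evalt v f :
  laurent_eval v (laurent_t F f) = wt (laurent_eval v f).
Proof.
rewrite laurent_eval_lmonom linear_sum; apply: eq_bigr => k _ /=.
by rewrite mul1r tpow_succ linearZ.
Qed.

Lemma laurent_evaltinv v f :
  laurent_eval v (laurent_tinv F f) = wtinv (laurent_eval v f).
Proof.
rewrite laurent_eval_lmonom linear_sum; apply: eq_bigr => k _ /=.
by rewrite mul1r tpow_pred linearZ.
Qed.

Lemma wD_tpow_ker v k : wD v = 0 -> wD (tpow k v) = k%:~R *: tpow k v.
Proof. by move=> Dv0; rewrite wD_tpow Dv0 add0r linearZ. Qed.

Lemma laurent_evald v f : wD v = 0 ->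
  laurent_eval v (laurent_d F f) = wd (laurent_eval v f).
Proof.
move=> Dv0; rewrite laurent_eval_lmonom linear_sum; apply: eq_bigr => k _ /=.
rewrite linearZ /= -[wd (tpow k v)]wtK -/(wD (tpow k v)) wD_tpow_ker //.
by rewrite linearZ /= -tpow_pred scalerA mulrC.
Qed.

(** The vectors t^k v are linearly independent when D v = 0 and v <> 0, being
eigenvectors of D with distinct eigenvalues. *)
Lemma tpow_free v (s : seq int) (c : int -> F) : v != 0 -> wD v = 0 ->
  uniq s -> \sum_(k <- s) c k *: tpow k v = 0 -> {in s, forall k, c k = 0}.
Proof.
move=> v0 Dv0; have tv0 k : tpow k v != 0.
  apply: contraNneq v0 => tv0.
  by rewrite -[v](tpowK (- k)) opprK tv0 linear0.
elim: s c => [//|a s IHs] c /= /andP[aNs us]; rewrite big_cons => sum0.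
have cs0 : {in s, forall k, c k = 0}.
  move=> k ks; have /eqP : c k * (k - a)%:~R = 0.
    apply: (IHs (fun k => c k * (k - a)%:~R)) ks => //.
    (* (D - a) removes the term of index a *)
    transitivity (wD (c a *: tpow a v + \sum_(j <- s) c j *: tpow j v)
       - a%:~R *: (c a *: tpow a v + \sum_(j <- s) c j *: tpow j v)).
      rewrite linearD scalerDr opprD addrACA linearZ /= wD_tpow_ker //.
      rewrite !scalerA [c a * _]mulrC subrr add0r linear_sum scaler_sumr -sumrB.
      apply: eq_bigr => j _ /=.
      rewrite linearZ /= wD_tpow_ker // !scalerA -scalerBl; congr (_ *: _).
      by rewrite rmorphB /= mulrBr [a%:~R * _]mulrC.
    by rewrite sum0 linear0 scaler0 subrr.
  rewrite mulf_eq0 intr_eq0 subr_eq0 => /orP[/eqP //|/eqP ka].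
  by rewrite -ka ks in aNs.
move=> k; rewrite inE => /predU1P[->|]; last exact: cs0.
move: sum0; rewrite big_seq big1 => [|j js]; last by rewrite cs0 ?scale0r.
by rewrite addr0 => /eqP; rewrite scaler_eq0 (negPf (tv0 a)) orbF => /eqP.
Qed.

Lemma laurent_eval_inj v : v != 0 -> wD v = 0 -> injective (laurent_eval v).
Proof.
move=> v0 Dv0 f g efg; apply/subr0_eq/malgP => k; rewrite mcoeff0.
case: (boolP (k \in msupp (f - g))) => [|kN]; last by rewrite mcoeff_outdom.
apply: (tpow_free v _ (mcoeff^~ (f - g)) v0 Dv0 (fset_uniq _)).
by rewrite -/(laurent_eval v (f - g)) linearB /= efg subrr.
Qed.

Hypothesis irrM : weyl_irreducible M.

Lemma laurent_eval_surj v : v != 0 -> wD v = 0 ->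
  forall w, exists f, laurent_eval v f = w.
Proof.
move=> v0 Dv0; apply: (proj2 irrM (fun w => exists f, laurent_eval v f = w)).
  split.
    split; first by exists 0; rewrite linear0.
    by move=> a _ _ [f <-] [g <-]; exists (a *: f + g); rewrite linearP.
  move=> _ [f <-]; split.
  - by exists (laurent_t F f); rewrite laurent_evalt.
  - by exists (laurent_tinv F f); rewrite laurent_evaltinv.
  - by exists (laurent_d F f); rewrite laurent_evald.
by exists v => //; exists << 1 *g 0 >>; rewrite laurent_evalU scale1r.
Qed.

Lemma weyl_iso_laurent_of_ker v : v != 0 -> wD v = 0 ->
  weyl_iso M (laurent_module F).
Proof.
move=> v0 Dv0; have injE := laurent_eval_inj v v0 Dv0.
have surjE w : exists f, laurent_eval v f == w.
  by have [f <-] := laurent_eval_surj v v0 Dv0 w; exists f.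
pose g w : laurent_module F := xchoose (surjE w).
have gK : cancel g (laurent_eval v) by move=> w; apply/eqP/(xchooseP (surjE w)).
have Kg : cancel (laurent_eval v) g by move=> f; apply: injE; rewrite gK.
have g_lin : linear g by apply: can2_linear Kg gK.
pose gL := GRing.isLinear.Build F M (laurent_module F) *:%R g g_lin.
pose gl : {linear M -> laurent_module F} := HB.pack g gL.
exists gl; split; first by exists (laurent_eval v).
move=> w; rewrite -[w]gK; split; rewrite /= Kg.
- by rewrite -laurent_evalt Kg.
- by rewrite -laurent_evaltinv Kg.
- by rewrite -laurent_evald ?Kg.
Qed.

End WeylModule.

(** Conversely, the preimage of the constant 1 is killed by D. *)
Lemma weyl_iso_laurent_ker (F : numFieldType) (M : weyl_module F) :
  weyl_iso M (laurent_module F) -> exists2 v : M, v != 0 & wD v = 0.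
Proof.
case=> f [[g fK gK] fP]; pose u : laurent_module F := << 1 *g 0 >>.
have u0 : u != 0.
  apply/eqP => /malgP /(_ 0); rewrite mcoeffUU mcoeff0 => /eqP.
  by rewrite oner_eq0.
have f0 : f 0 = 0 by rewrite linear0.
exists (g u).
  by apply: contraNneq u0 => gu0; rewrite -[u]gK gu0 f0.
apply: (can_inj fK); rewrite f0 /wD.
have [-> _ _] := fP (wd (g u)); have [_ _ ->] := fP (g u); rewrite gK.
apply/malgP => j; rewrite !lmonomE mcoeffU mcoeff0 opprK subrK mul1r.
by case: eqP => [<-|_]; rewrite ?mul0r ?mulr0.
Qed.

(** * Submodules of H *)

Section HModule.
Variables (F : numFieldType) (e : bool) (b : F) (M : weyl_module F).
Implicit Types (v w : M).

Lemma HactG k v w : Hact e b (SG k) (v, w) =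
  (- tpow (k + e%:Z) w, tpow k (wD v + (2 * k%:~R * b) *: v)).
Proof.
rewrite /Hact /diag /theta /dtheta /=; congr (_, _).
  rewrite -[LHS]/(tpow k (0 + _ *: 0 - tpow e%:Z w)) scaler0 !add0r.
  by rewrite (linearN (@tpow F M k)) -tpowD.
by rewrite -[LHS]/(tpow k (wD v + _ *: v - tpow e%:Z 0)) linear0 subr0.
Qed.

Lemma HactL m v w : Hact e b (SL m) (v, w) =
  (- tpow m (wD v + ((m%:~R - 2 * eps F e) * b) *: v),
   - tpow m (wD w + ((m%:~R - 2 * eps F e) * b) *: w
             + ((m%:~R + 2 * eps F e) / 2) *: w)).
Proof.
rewrite /Hact /diag /theta /dtheta /=; congr (_, _).
by rewrite -[LHS]/(- tpow m (wD v + _ *: v + _ *: 0)) scaler0 addr0.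
Qed.

(** The subspaces N0 and N1 of M attached to a subspace N of M + \overline{M},
written as pairs: v is in N0 if v is in N, and w is in N1 if \overline{w} is
in N. *)
Definition even_part (N : M * M -> Prop) v := N (v, 0).

Definition odd_part (N : M * M -> Prop) w := N (0, w).

Section Submodule.
Variable N : M * M -> Prop.
Hypothesis sN : @svir_submodule F e (Hmod e b M) N.
Hypothesis nzN : exists2 u, N u & u != 0.

Local Notation N0 := (even_part N).
Local Notation N1 := (odd_part N).

Lemma svir_sub_even : subspace N0.
Proof.
have [[N00 NP] _ _] := sN; split=> // a u v Nu Nv.
rewrite /even_part; have -> : (a *: u + v, 0) = a *: (u, 0) + (v, 0) :> M * M.
  by rewrite -[RHS]/(_, a *: 0 + 0) scaler0 addr0.
exact: NP.
Qed.

Lemma svir_sub_odd : subspace N1.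
Proof.
have [[N00 NP] _ _] := sN; split=> // a u v Nu Nv.
rewrite /odd_part; have -> : (0, a *: u + v) = a *: (0, u) + (0, v) :> M * M.
  by rewrite -[RHS]/(a *: 0 + 0, _) scaler0 addr0.
exact: NP.
Qed.

Lemma svir_sub_even_odd k v : N0 v -> N1 (tpow k (wD v + (2 * k%:~R * b) *: v)).
Proof.
have [_ _ NG] := sN => /(NG (SG k)).
by rewrite -[sact _ _]/(Hact e b _ _) HactG linear0 oppr0.
Qed.

Lemma svir_sub_odd_even k w : N1 w -> N0 (tpow k w).
Proof.
(* G_p with p = k - eps acts on the odd part as - t^k *)
have [_ _ NG] := sN => /(NG (SG (k - e%:Z))).
rewrite -[sact _ _]/(Hact e b _ _) HactG subrK scaler0 linear0 addr0 linear0.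
move=> Ntw; rewrite -[tpow k w]opprK; exact: subspaceN svir_sub_even Ntw.
Qed.

Lemma svir_sub_part v w : N (v, w) -> N0 v /\ N1 w.
Proof.
have [_ Npart _] := sN => Nvw; split.
  exact: (Npart false) Nvw.
exact: (Npart true) Nvw.
Qed.

Lemma svir_sub_even_neq0 : exists2 v, N0 v & v != 0.
Proof.
have [[v w] /svir_sub_part[Nv Nw] nz] := nzN.
have [v0|v0] := eqVneq v 0; last by exists v.
exists w; first exact: (svir_sub_odd_even 0).
by apply: contraNneq nz => w0; rewrite v0 w0.
Qed.

Lemma svir_sub_full : (forall v, N0 v) -> (forall w, N1 w) -> forall u, N u.
Proof.
move=> N0T N1T [v w]; have [sN' _ _] := sN.
have -> : (v, w) = (v, 0) + (0, w) :> M * M.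
  by rewrite -[RHS]/(v + 0, 0 + w) addr0 add0r.
exact: subspaceD sN' (N0T v) (N1T w).
Qed.

Hypothesis irrM : weyl_irreducible M.

Lemma svir_sub_even_full : b != 0 -> forall v, N0 v.
Proof.
move=> b0; have sN0 := svir_sub_even.
have Nk m k v : N0 v -> N0 (tpow m (wD v + (2 * k%:~R * b) *: v)).
  move=> Nv; rewrite -[m](subrK k) -tpowD.
  exact/svir_sub_odd_even/svir_sub_even_odd.
have ND m v : N0 v -> N0 (tpow m (wD v)).
  by move=> /(Nk m 0); rewrite mulr0 mul0r scale0r addr0.
apply: (proj2 irrM) svir_sub_even_neq0; apply: weyl_submoduleP => // [m v Nv|v].
  have b2 : 2 * b != 0 by rewrite mulf_neq0 // pnatr_eq0.
  (* 2b t^m = t^m (D + 2b) - t^m D *)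
  have -> : tpow m v =
      (2 * b)^-1 *: (tpow m (wD v + (2 * 1%:~R * b) *: v) - tpow m (wD v)).
    rewrite -linearB addrAC subrr add0r mulr1 !linearZ /= scalerA.
    by rewrite mulfV ?scale1r.
  by apply: subspaceZ => //; apply: subspaceB => //; [apply: Nk | apply: ND].
exact: (ND 0).
Qed.

(** D + k (2b - 1) = t^k (D + 2kb) t^(-k). *)
Lemma svir_sub_odd_affine : (forall v, N0 v) ->
  forall (k : int) v, N1 (wD v + (k%:~R * (2 * b - 1)) *: v).
Proof.
move=> N0T k v; have := svir_sub_even_odd k (tpow (- k) v) (N0T _).
rewrite linearD linearZ /= tpow_wD tpowK -addrA -scaleNr -scalerDl.
by congr (N1 (_ + _ *: _)); rewrite mulrBr mulr1 [RHS]addrC mulrCA mulrA.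
Qed.

Lemma svir_sub_full_generic : b != 0 -> b != 2^-1 -> forall u, N u.
Proof.
move=> b0 bh; have N0T := svir_sub_even_full b0.
apply: svir_sub_full => // w; have Naff := svir_sub_odd_affine N0T.
have c0 : 2 * b - 1 != 0.
  rewrite subr_eq0; apply: contraNneq bh => b21.
  by rewrite -[b](mulKf (_ : 2 != 0)) ?b21 ?mulr1 // pnatr_eq0.
(* (2b - 1) w is the difference of the cases k = 1 and k = 0 *)
have -> : w = (2 * b - 1)^-1 *:
    ((wD w + (1%:~R * (2 * b - 1)) *: w) - (wD w + (0%:~R * (2 * b - 1)) *: w)).
  rewrite mul0r scale0r addr0 addrAC subrr add0r mul1r scalerA.
  by rewrite mulVf ?scale1r.
have s1 := svir_sub_odd.
by apply: subspaceZ => //; apply: subspaceB.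
Qed.

Lemma svir_sub_full_half : b != 0 -> (forall w, exists v, w = wD v) ->
  forall u, N u.
Proof.
move=> b0 Dsurj; have N0T := svir_sub_even_full b0.
apply: svir_sub_full => // w; have [v ->] := Dsurj w.
by have := svir_sub_odd_affine N0T 0 v; rewrite mul0r scale0r addr0.
Qed.

Lemma svir_sub_full_0 : b = 0 -> (forall v, wD v = 0 -> v = 0) ->
  forall u, N u.
Proof.
move=> b0 Dinj; have N01 k v : N0 v -> N1 (tpow k (wD v)).
  by move/(svir_sub_even_odd k); rewrite b0 mulr0 scale0r addr0.
have s1 := svir_sub_odd.
(* W = {w | t^m w in N1 for all m} is a D-submodule containing D(N0) *)
have WT : forall w, (forall m, N1 (tpow m w)).
  apply: (proj2 irrM (fun w => forall m, N1 (tpow m w))).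
    apply: weyl_submoduleP.
    - split=> [m|a u v Nu Nv m]; first by rewrite linear0; apply: subspace0.
      by rewrite linearP; exact: (proj2 s1 _ _ _ (Nu m) (Nv m)).
    - by move=> k v Nv m; rewrite tpowD.
    - by move=> v Nv m; apply: N01; apply: (svir_sub_odd_even 0); apply: (Nv 0).
  have [v Nv v0] := svir_sub_even_neq0.
  exists (wD v); first by move=> m; apply: N01.
  by apply: contraNneq v0 => /Dinj ->.
have N1T w : N1 w := WT w 0.
by apply: svir_sub_full => // v; apply: (svir_sub_odd_even 0).
Qed.

End Submodule.

(** * The submodules in the reducible cases *)

(** For b = 0, ker D is an even submodule: G_p kills it, and so does
L_m, which acts as - t^m D on the even part. *)
Lemma ker_svir_submodule : b = 0 ->
  @svir_submodule F e (Hmod e b M) (fun u : M * M => wD u.1 = 0 /\ u.2 = 0).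
Proof.
move=> b0; split.
- split=> [|a [u1 u2] [v1 v2] [/= Du u0] [/= Dv v0]].
    by rewrite /= linear0.
  split.
    change (wD (a *: u1 + v1) = 0).
    by rewrite linearD linearZ /= Du Dv scaler0 addr0.
  by change (a *: u2 + v2 = 0); rewrite u0 v0 scaler0 addr0.
- by move=> [] [v w] [/= Dv w0]; rewrite /part /= ?linear0.
- move=> x [v w] [Dv w0]; rewrite /= in Dv w0; rewrite w0.
  rewrite -[sact _ _]/(Hact e b _ _).
  case: x => k; rewrite ?HactG ?HactL b0 !mulr0 !scale0r Dv /=.
    by rewrite scaler0 linear0 !addr0 !linear0.
  by rewrite addr0 !linear0.
Qed.

(** For b = 1/2, M + D(M) is a submodule: G_(k+eps) sends v in M to
t^k (D + k) v = D (t^k v), and L_m acts on the odd part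
as - t^m (D + m) = - D t^m. *)
Lemma image_svir_submodule : b = 2^-1 ->
  @svir_submodule F e (Hmod e b M) (fun u : M * M => exists v, u.2 = wD v).
Proof.
move=> bh; split.
- split=> [|a [u1 u2] [v1 v2] [u /= ->] [v /= ->]].
    by exists 0; rewrite !linear0.
  by exists (a *: u + v); rewrite linearP.
- move=> [] [v w] [x /= wE]; rewrite /part /=; first by exists x.
  by exists 0; rewrite linear0.
- move=> x [v w] [y wE]; rewrite /= in wE; rewrite wE.
  rewrite -[sact _ _]/(Hact e b _ _).
  case: x => k; rewrite ?HactG ?HactL /=.
    exists (- tpow k (wD y)); rewrite linearN /= wD_tpow -addrA -scalerDl bh.
    rewrite -mulrDl addrACA addNr addr0 -mulr2n -[_ *+ 2]mulr_natr mulfK //.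
    by rewrite pnatr_eq0.
  exists (tpow k v); rewrite wD_tpow bh mulrAC mulfV ?mul1r //.
  by rewrite pnatr_eq0.
Qed.

End HModule.

Theorem theorem4p5 (R : realType) (e : bool) (b : R[i])
    (M : weyl_module R[i]) (hM : weyl_irreducible M) :
  svir_irreducible (Hmod e b M) <->
  [\/ b <> 0 /\ b <> 2^-1,
      b = 0 /\ ~ weyl_iso M (laurent_module R[i])
    | b = 2^-1 /\ (forall w : M, exists v : M, w = wD v)].
Proof.
have [[x x0] _] := hM.
have nz2 : 2^-1 != 0 :> R[i] by rewrite invr_eq0 pnatr_eq0.
split=> [[_ irrH]|cases].
- have [b0|/eqP b0] := eqVneq b 0.
    apply: Or32; split=> // /weyl_iso_laurent_ker[v v0 Dv].
    have [] := irrH _ (ker_svir_submodule _ e b M b0) _ (0, x).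
      by exists (v, 0) => //; apply: contraNneq v0 => -[->].
    by move=> _ /= /eqP; apply/negP.
  have [bh|/eqP bh] := eqVneq b 2^-1; last by apply: Or31.
  apply: Or33; split=> // w.
  apply: (irrH _ (image_svir_submodule _ e b M bh) _ (0, w)).
  exists (x, 0); first by exists 0; rewrite linear0.
  by apply: contraNneq x0 => -[->].
- split; first by exists (x, 0); apply: contraNneq x0 => -[->].
  move=> N sN nzN.
  case: cases => [[/eqP b0 /eqP bh]|[b0 nL]|[bh Dsurj]].
  + exact: svir_sub_full_generic sN nzN hM b0 bh.
  + apply: (svir_sub_full_0 _ _ _ _ _ sN nzN hM b0) => v Dv.
    apply/eqP; apply/negP => /negP v0; apply: nL.
    exact: weyl_iso_laurent_of_ker v0 Dv.
  + by apply: (svir_sub_full_half _ _ _ _ _ sN nzN hM) Dsurj; rewrite bh.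
Qed.
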